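(* Consider iteration $k+1$ of the DD algorithm (defined in the context), and let $\alpha,\beta,\xi,N^0,N^+,N^-$ be the quantities computed in that iteration. Let $F^{k+1}\in\mathbb R^{q_k\times q_{k+1}}$, $G^{k+1}\in\mathbb R^{q_k\times p_{k+1}}$, $D^{k+1}\in\mathbb R^{p_k\times p_{k+1}}$ be the constant matrices defined in the context; then $D^{k+1}\ge0$. Let $P^{k+1}_\pi\in\mathbb R^{(q_k+p_k)\times(q_k+p_k)}$ be the permutation matrix that does not resequence $\theta^k(x_0;x)$ but permutes the entries of $\mu^k(x_0;x)$ so that, when Case 2 is executed at iteration $k+1$, the indices in $N^0$ are followed by those in $N^+$ and finally by those in $N^-$. (i) Assume that at iteration $k+1$ either ($q_k\ne0$ and $\alpha\neq0$) or $N^+\ne\emptyset$. Then the symbolic expressions for the barycentric coordinates satisfy $$\begin{pmatrix}\theta^k(x_0;x)\\ \mu^k(x_0;x)\end{pmatrix}=(P^{k+1}_\pi)^{\top}\begin{pmatrix}F^{k+1}&G^{k+1}\\0&D^{k+1}\end{pmatrix}\begin{pmatrix}\theta^{k+1}(x_0;x)\\ \mu^{k+1}(x_0;x)\end{pmatrix}.\qquad( * )$$ (ii) If $N^+=\emptyset$ and either $q_k=0$ or $\alpha=0$, then $( * )$ still holds numerically, i.e. upon evaluation at every $(x_0;x)\in K^{k+1}$. (Here the coordinates $\mu^k_j(x_0;x)$, $j\in N^-$, are dropped at iteration $k+1$, and $( * )$ states that they evaluate to zero for all $(x_0;x)\in K^{k+1}$.) (iii) Regardless of whether $( * )$ holds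 symbolically, $$\begin{pmatrix}L^{k+1}&R^{k+1}\end{pmatrix}=\begin{pmatrix}L^k&R^k\end{pmatrix}(P^{k+1}_\pi)^{\top}\begin{pmatrix}F^{k+1}&G^{k+1}\\0&D^{k+1}\end{pmatrix}.$$
   Context: DD algorithm. Input $\bar A\in\mathbb R^{m\times(n+1)}$ with rows $\bar A_{1,:},\dots,\bar A_{m,:}$. Coordinates of $\mathbb R^{n+1}$ are indexed $0,\dots,n$; points are written $(x_0;x)$; $e_0,\dots,e_n$ are the unit vectors. Let $K^k=\{(x_0;x)\mid x_0\ge0,\ \bar A_{i,:}(x_0;x)\ge0,\ i=1,\dots,k\}$. The algorithm produces matrices $R^k$ ($p_k$ columns) and $L^k$ ($q_k$ columns) with $n+1$ rows, and vectors of rational functions $\mu^k$ (length $p_k$) and $\theta^k$ (length $q_k$) of $(x_0;x)$, called barycentric coordinates. Initialization: $L^0=(e_1,\dots,e_n)$, $\theta^0=x$, $R^0=(e_0)$, $\mu^0=(x_0)$. Iteration $k=1,\dots,m$: write $L,\theta,R,\mu,p,q$ for $L^{k-1},\theta^{k-1},R^{k-1},\mu^{k-1},p_{k-1},q_{k-1}$, and set $\alpha=\bar A_{k,:}L$, $\beta=\bar A_{k,:}R$. Case 1 ($q>0$ and $\alpha\ne0$): let $\xi=\min\{i\mid\alpha_i\neq0\}$; if $\alpha_\xi<0$ replace (in place) $L_{:,\xi},\theta_\xi,\alpha_\xi$ by their negatives. Set $\mu^k=\bigl(\theta_\xi+\sum_{j=\xi+1}^{q}\alpha_j\theta_j/\alpha_\xi+\sum_{j=1}^{p}\beta_j\mu_j/\alpha_\xi,\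 (\mu_j/\alpha_\xi)_{j=1}^{p}\bigr)$, $\theta^k=\bigl((\theta_j)_{j<\xi},(\theta_j/\alpha_\xi)_{j>\xi}\bigr)$, $R^k=\bigl(L_{:,\xi},(\alpha_\xi R_{:,j}-\beta_jL_{:,\xi})_{j=1}^{p}\bigr)$, $L^k=\bigl((L_{:,j})_{j<\xi},(\alpha_\xi L_{:,j}-\alpha_jL_{:,\xi})_{j>\xi}\bigr)$. Case 2 (otherwise): let $N^-,N^0,N^+$ be the sets of $i$ with $\beta_i<0$, $=0$, $>0$, and $N_{\rm tot}=\sum_{i\in N^+}\mu_i\beta_i$. Set $\mu^k=\bigl(\mu_{N^0},(\mu_i+\sum_{j\in N^-}\mu_j\mu_i\beta_j/N_{\rm tot})_{i\in N^+},(\mu_j\mu_i/N_{\rm tot})_{i\in N^+,j\in N^-}\bigr)$, $R^k=\bigl(R_{:,N^0},R_{:,N^+},(\beta_iR_{:,j}-\beta_jR_{:,i})_{i\in N^+,j\in N^-}\bigr)$, $\theta^k=\theta$, $L^k=L$; the pairs $(i,j)$ are listed with all $j\in N^-$ for the first $i\in N^+$, then all $j\in N^-$ for the second $i$, and so on. When functions are evaluated numerically at a point of $K^k$ where some $N_{\rm tot}$ vanishes, quotients with that $N_{\rm tot}$ as denominator are given the value $0$. Matrices for iteration $k+1$. If Case 1 is executed ($L^k,\theta^k,\alpha$ being taken after the in-place sign change, so $\alpha_\xi>0$): in block form with row blocks of sizes $\xi-1,1,q_k-\xi$, $F^{k+1}=\begin{pmatrix}I_{\xi-1}&0\\0&-\alpha_{[\xi+1:q_k]}\\0&\alpha_\xi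 I_{q_k-\xi}\end{pmatrix}$, $G^{k+1}=\begin{pmatrix}0&0_{(\xi-1)\times p_k}\\1&-\beta\\0&0_{(q_k-\xi)\times p_k}\end{pmatrix}$, $D^{k+1}=\begin{pmatrix}0_{p_k\times1}&\alpha_\xi I_{p_k}\end{pmatrix}$, and $P_\pi^{k+1}$ is the identity. If Case 2 is executed: $F^{k+1}=I_{q_k}$, $G^{k+1}=0$, and $D^{k+1}$ has rows indexed by $N^0,N^+,N^-$ (in this order) and columns indexed by $N^0$, $N^+$, $N^+\times N^-$ (in this order, the pairs $(i,j)\in N^+\times N^-$ being listed with all $j\in N^-$ for the first $i\in N^+$, then all $j\in N^-$ for the second $i$, and so on): column $j\in N^0$ is the unit vector at row $j$; column $i\in N^+$ is the unit vector at row $i$; column $(i,j)\in N^+\times N^-$ has entry $-\beta_j$ at row $i$, entry $\beta_i$ at row $j$, and zeros elsewhere. *)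

(* Defs.v *)
From HB Require Import structures.
From mathcomp Require Import all_boot all_order all_algebra all_fingroup.
From mathcomp Require Import reals.
From mathcomp Require Import mpoly.

Set Implicit Arguments.
Unset Strict Implicit.
Unset Printing Implicit Defensive.

Import Order.TTheory GRing.Theory Num.Theory.
Local Open Scope ring_scope.

(* The double description (DD) algorithm with barycentric coordinates.         *)
(* Index sets 1..q are ordinal types 'I_q, so indices start at 0.  Points      *)
(* (x_0; x) are column vectors of height n.+1, with x_0 in row ord0.           *)

(* Column generators of a cone: L (lnum columns, the lineality part) and R     *)
(* (rnum columns, the rays).                                                   *)
Record gens (R : realType) (n : nat) := Gens {
  lnum : nat;
  rnum : nat;
  lmx : 'M[R]_(n.+1, lnum);
  rmx : 'M[R]_(n.+1, rnum) }.

(* The pair (theta, mu) of barycentric coordinates, with values in a field F.  *)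
(* F is the field of rational functions for the symbolic expressions, and R    *)
(* itself for their numerical values; iota embeds the real constants in F.     *)
Definition coords (R : realType) (n : nat) (F : fieldType) (g : gens R n)
    : Type :=
  ('cV[F]_(lnum g) * 'cV[F]_(rnum g))%type.

Section Iteration.
Variables (R : realType) (n : nat).
Implicit Types (a : 'rV[R]_n.+1) (g : gens R n).

Definition alpha a g : 'rV[R]_(lnum g) := a *m lmx g.
Definition beta a g : 'rV[R]_(rnum g) := a *m rmx g.

(* The least index of a nonzero entry.  It exists iff q > 0 and v <> 0, so     *)
(* Case 1 is executed exactly when pivot (alpha a g) is some index.            *)
Definition pivot (q : nat) (v : 'rV[R]_q) : option 'I_q :=
  [pick i | (v 0 i != 0) && [forall j : 'I_q, (j < i)%N ==> (v 0 j == 0)]].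

(* The factor by which column i of L and entry i of theta are multiplied in    *)
(* the in-place sign change preceding Case 1.                                  *)
Definition flip a g (i : 'I_(lnum g)) : R :=
  if (pivot (alpha a g) == Some i) && (alpha a g 0 i < 0) then -1 else 1.

Definition normalize a g : gens R n :=
  Gens (\matrix_(r, i) (flip a i * lmx g r i)) (rmx g).

Definition Nneg (p : nat) (b : 'rV[R]_p) : {set 'I_p} := [set i | b 0 i < 0].
Definition Nzero (p : nat) (b : 'rV[R]_p) : {set 'I_p} := [set i | b 0 i == 0].
Definition Npos (p : nat) (b : 'rV[R]_p) : {set 'I_p} := [set i | 0 < b 0 i].

(* N+ x N-.  enum_val on this set follows the enumeration of the product type, *)
(* which is lexicographic: all j for the first i, then all j for the second i. *)
Definition Npair (p : nat) (b : 'rV[R]_p) : {set 'I_p * 'I_p} :=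
  setX (Npos b) (Nneg b).

(* Columns are indexed by j : 'I_q.-1, and lift xi j skips the pivot xi.       *)
Definition step1 a g (xi : 'I_(lnum g)) : gens R n :=
  let al := alpha a g in let be := beta a g in
  Gens
    (\matrix_(r < n.+1, j < (lnum g).-1)
       (if (j < xi)%N then lmx g r (lift xi j)
        else al 0 xi * lmx g r (lift xi j) - al 0 (lift xi j) * lmx g r xi))
    (row_mx (col xi (lmx g))
       (\matrix_(r, j) (al 0 xi * rmx g r j - be 0 j * lmx g r xi))).

Definition step2 a g : gens R n :=
  let be := beta a g in
  Gens (lmx g)
    (row_mx
       (row_mx (\matrix_(r < n.+1, c < #|Nzero be|) rmx g r (enum_val c))
               (\matrix_(r < n.+1, c < #|Npos be|) rmx g r (enum_val c)))
       (\matrix_(r < n.+1, c < #|Npair be|)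
          let: (i, j) := enum_val c in
          be 0 i * rmx g r j - be 0 j * rmx g r i)).

Definition step a g (o : option 'I_(lnum g)) : gens R n :=
  if o is Some xi then step1 a xi else step2 a g.

(* To be applied to an output of normalize a, so that the pivot is positive.  *)
Definition next_gens a g : gens R n := step a (pivot (alpha a g)).

Definition Fmx a g : 'M[R]_(lnum g, lnum (next_gens a g)) :=
  match pivot (alpha a g) as o return 'M[R]_(lnum g, lnum (step a o)) with
  | Some xi =>
      let al := alpha a g in
      \matrix_(i < lnum g, j < (lnum g).-1)
        (if i == lift xi j then (if (j < xi)%N then 1 else al 0 xi)
         else if (i == xi) && ~~ (j < xi)%N then - al 0 (lift xi j)
         else 0)
  | None => 1%:M
  end.

Definition Gmx a g : 'M[R]_(lnum g, rnum (next_gens a g)) :=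
  match pivot (alpha a g) as o return 'M[R]_(lnum g, rnum (step a o)) with
  | Some xi =>
      row_mx (\matrix_(i < lnum g, c < 1) (i == xi)%:R)
             (\matrix_(i, j) (if i == xi then - beta a g 0 j else 0))
  | None => 0
  end.

(* The sequence N0, N+, N-, each listed increasingly, as a permutation of 'I_p *)
Definition Nseq (p : nat) (b : 'rV[R]_p) : seq 'I_p :=
  enum (Nzero b) ++ enum (Npos b) ++ enum (Nneg b).

Lemma Nseq_uniq (p : nat) (b : 'rV[R]_p) : uniq (Nseq b).
Proof.
rewrite !cat_uniq !enum_uniq /= andbT; apply/andP; split.
  apply/hasPn => i; rewrite mem_cat !mem_enum !inE => /orP[] h.
    by rewrite gt_eqF.
  by rewrite lt_eqF.
by apply/hasPn => i; rewrite !mem_enum !inE => h; rewrite -leNgt ltW.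
Qed.

Lemma Nseq_size (p : nat) (b : 'rV[R]_p) : size (Nseq b) = p.
Proof.
rewrite -[RHS]card_ord -(card_uniqP (Nseq_uniq b)); apply: eq_card => i.
by rewrite !mem_cat !mem_enum !inE; case: ltgtP.
Qed.

Lemma Nseq_inj (p : nat) (b : 'rV[R]_p) :
  injective (fun i : 'I_p => nth i (Nseq b) i).
Proof.
move=> i j; rewrite (set_nth_default i j) ?Nseq_size // => /eqP.
by rewrite nth_uniq ?Nseq_size ?Nseq_uniq // => /eqP/val_inj.
Qed.

Definition Nperm (p : nat) (b : 'rV[R]_p) : 'S_p := perm (@Nseq_inj p b).

(* In Case 2, row r carries the label Nperm b r in N0, N+, N- (in this order). *)
Definition Dmx a g : 'M[R]_(rnum g, rnum (next_gens a g)) :=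
  match pivot (alpha a g) as o return 'M[R]_(rnum g, rnum (step a o)) with
  | Some xi => row_mx (0 : 'M_(rnum g, 1)) (alpha a g 0 xi)%:M
  | None =>
      let be := beta a g in
      row_mx
        (row_mx (\matrix_(r < rnum g, c < #|Nzero be|)
                    (Nperm be r == enum_val c)%:R)
                (\matrix_(r < rnum g, c < #|Npos be|)
                    (Nperm be r == enum_val c)%:R))
        (\matrix_(r < rnum g, c < #|Npair be|)
           let: (i, j) := enum_val c in
           if Nperm be r == i then - be 0 j
           else if Nperm be r == j then be 0 i
           else 0)
  end.

(* perm_mx s *m v lists the entries v (s 0), v (s 1), and so on.               *)
Definition Pmx a g : 'M[R]_(lnum g + rnum g) :=
  if pivot (alpha a g) is Some _ then 1%:M
  else block_mx 1%:M 0 0 (perm_mx (Nperm (beta a g))).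

Section Coordinates.
Variables (F : fieldType) (iota : {rmorphism R -> F}).

Definition normalize_coords a g (c : coords F g) : coords F (normalize a g) :=
  (\col_i (iota (flip a i) * c.1 i 0), c.2).

Definition step1_coords a g (xi : 'I_(lnum g)) (c : coords F g) :
    coords F (step1 a xi) :=
  let al := alpha a g in let be := beta a g in
  let theta j := c.1 j 0 in let mu j := c.2 j 0 in
  (\col_(j < (lnum g).-1)
     (if (j < xi)%N then theta (lift xi j)
      else theta (lift xi j) / iota (al 0 xi)),
   col_mx
     (theta xi
      + \sum_(j < lnum g | (xi < j)%N) iota (al 0 j) * theta j / iota (al 0 xi)
      + \sum_(j < rnum g) iota (be 0 j) * mu j / iota (al 0 xi))%:M
     (\col_j (mu j / iota (al 0 xi)))).

(* Division by zero yields 0 in F: this is the convention for the numerical    *)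
(* evaluation of the quotients by Ntot.                                        *)
Definition step2_coords a g (c : coords F g) : coords F (step2 a g) :=
  let be := beta a g in let mu j := c.2 j 0 in
  let Ntot := \sum_(i in Npos be) mu i * iota (be 0 i) in
  (c.1,
   col_mx
     (col_mx
        (\col_(k < #|Nzero be|) mu (enum_val k))
        (\col_(k < #|Npos be|)
           (mu (enum_val k)
            + \sum_(j in Nneg be)
                mu j * mu (enum_val k) * iota (be 0 j) / Ntot)))
     (\col_(k < #|Npair be|)
        let: (i, j) := enum_val k in mu j * mu i / Ntot)).

Definition step_coords a g (o : option 'I_(lnum g)) (c : coords F g) :
    coords F (step a o) :=
  match o as o return coords F (step a o) with
  | Some xi => step1_coords a xi c
  | None => step2_coords a c
  end.

Definition next_coords a g (c : coords F g) : coords F (next_gens a g) :=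
  step_coords a (pivot (alpha a g)) c.

End Coordinates.
End Iteration.

Section Algorithm.
Variables (R : realType) (m n : nat) (A : 'M[R]_(m, n.+1)).

(* Row number k of A, counted from 0; the default 0 is not used for k < m.     *)
Definition arow (k : nat) : 'rV[R]_n.+1 :=
  if insub k is Some i then row (i : 'I_m) A else 0.

(* (L^k, R^k) as computed by iteration k. *)
Fixpoint dd (k : nat) : gens R n :=
  if k is k'.+1 then next_gens (arow k') (normalize (arow k') (dd k'))
  else Gens (\matrix_(r < n.+1, j < n) (r == lift ord0 j)%:R)
            (\matrix_(r < n.+1, j < 1) (r == ord0)%:R).

(* (L^k, R^k) after the in-place sign change at the start of iteration k.+1. *)
Definition dd_in (k : nat) : gens R n := normalize (arow k) (dd k).

Definition inK (k : nat) (x : 'cV[R]_n.+1) : Prop :=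
  0 <= x ord0 0 /\ forall i : 'I_m, (i < k)%N -> 0 <= (A *m x) i 0.

Section Coordinates.
Variables (F : fieldType) (iota : {rmorphism R -> F}) (x : 'cV[F]_n.+1).

Fixpoint dd_coords (k : nat) : coords F (dd k) :=
  match k return coords F (dd k) with
  | 0 => (\col_(j < n) x (lift ord0 j) 0, \col_(j < 1) x ord0 0)
  | k'.+1 =>
      next_coords iota (arow k') (normalize_coords iota (arow k') (dd_coords k'))
  end.

Definition dd_coords_in (k : nat) : coords F (dd_in k) :=
  normalize_coords iota (arow k) (dd_coords k).

End Coordinates.

Definition ratfun : fieldType := {fraction {mpoly R[n.+1]}}.

Definition ratconst : {rmorphism R -> ratfun} :=
  @tofrac {mpoly R[n.+1]} \o @mpolyC n.+1 R.

Definition ratvar : 'cV[ratfun]_n.+1 :=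
  \col_i @tofrac {mpoly R[n.+1]} (mpolyX R U_(i)%MM).

Definition symbolic (k : nat) : coords ratfun (dd k) :=
  dd_coords ratconst ratvar k.
Definition symbolic_in (k : nat) : coords ratfun (dd_in k) :=
  dd_coords_in ratconst ratvar k.

(* The values at x of the expressions computed by symbolic: the same program,  *)
(* run on real numbers, with quotients by a vanishing Ntot equal to 0.         *)
Definition numeric (x : 'cV[R]_n.+1) (k : nat) : coords R (dd k) :=
  dd_coords idfun x k.
Definition numeric_in (x : 'cV[R]_n.+1) (k : nat) : coords R (dd_in k) :=
  dd_coords_in idfun x k.

End Algorithm.

(* Main.v *)
Require Import Defs.
From mathcomp Require Import all_boot all_order all_algebra all_fingroup.
From mathcomp Require Import reals.
From mathcomp Require Import mpoly zify ring lra.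

Set Implicit Arguments.
Unset Strict Implicit.
Unset Printing Implicit Defensive.

Import Order.TTheory GRing.Theory Num.Theory.
Local Open Scope ring_scope.

(** Write M for the block matrix with blocks F, G, 0, D, after the rows of D have
been brought back to the original order of mu by P^T ([transfer], one formula
per case of the algorithm).  For a single iteration, with (L, R), c = (theta, mu)
before it and (L', R'), c' after it, everything is an entrywise computation.

The relation (L' R') = (L R) M holds unconditionally ([gens_step]).  For the
coordinates, M c' = c in Case 1 because alpha_xi is nonzero.  In Case 2, M c'
agrees with c, except that the entries mu_j with j in N- are replaced by 0 when
N_tot = 0 ([step2D_mu]).  So M c' = c as soon as N_tot <> 0, or all mu_j with
j in N- are already 0 ([coords_step]).

Numerically, (L R) c = x and mu >= 0 at every point x of K^k ([numeric_inK]).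
By induction: where N_tot = 0, the nonnegative mu_i with i in N+ vanish, and then
0 <= a x = sum_(j in N-) beta_j mu_j forces mu_j = 0 for j in N-
([Nneg_vanish]).  This covers the case N+ = empty.

Symbolically, in Case 2 with N+ nonempty, N_tot must be nonzero as a rational
function.  It suffices to find one point x at which all the earlier expressions
are defined and every mu_i is positive, for then N_tot is positive at x.  The
existence of x does not follow from the geometry of K^k, which may have empty
interior; and after an iteration that drops some mu_j, the vector
y(x) = (L R) c(x) need no longer be x.  What survives is that y takes values
arbitrarily close to each point of the relative interior of the cone generated
by L and R, with all mu_i positive.  Closeness is measured by finite families of
linear forms that are positive at the target ([cone_dense]); this is preserved
by each iteration ([dense_step]).  In Case 1, or if N+ is nonempty, the form a
is positive on the relative interior of the new cone, which lies in that of the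
old one, so a is added to the family ([dense_open]).  If N+ is empty and
alpha = 0, the new cone is the face a = 0.  A target z in its relative interior
is approached through z + d w, where w is the sum of the rays in N- and d > 0 is
small.  Each form b of the family is replaced by b + K a, with K so large that
positivity of b + K a at y(x) implies positivity of b once the mu_j with j in N-
have been dropped ([dense_face]). *)

(** * The matrix of one iteration *)

Section Step.
Variables (R : realType) (n : nat).
Implicit Types (a : 'rV[R]_n.+1) (g : gens R n).

(** The point L theta + R mu with coordinates c = (theta, mu). *)
Definition point g (c : coords R g) : 'cV[R]_n.+1 :=
  lmx g *m c.1 + rmx g *m c.2.

(** The blocks F, G and D of Case 1 with pivot xi.  Column j of F stands for the
column lift xi j of L, since the pivot is skipped. *)
Definition step1F a g (xi : 'I_(lnum g)) : 'M[R]_(lnum g, (lnum g).-1) :=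
  \matrix_(i, j)
    (if i == lift xi j then (if (j < xi)%N then 1 else alpha a g 0 xi)
     else if (i == xi) && ~~ (j < xi)%N then - alpha a g 0 (lift xi j) else 0).

Definition step1G a g (xi : 'I_(lnum g)) : 'M[R]_(lnum g, 1 + rnum g) :=
  row_mx (\matrix_(i, c) (i == xi)%:R)
         (\matrix_(i, j) (if i == xi then - beta a g 0 j else 0)).

Definition step1D a g (xi : 'I_(lnum g)) : 'M[R]_(rnum g, 1 + rnum g) :=
  row_mx 0 (alpha a g 0 xi)%:M.

(** The block D of Case 2, with its rows in the original order of the entries of
mu. *)
Definition step2D a g : 'M[R]_(rnum g, rnum (step2 a g)) :=
  let be := beta a g in
  row_mx
    (row_mx (\matrix_(r < rnum g, c < #|Nzero be|) (r == enum_val c)%:R)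
            (\matrix_(r < rnum g, c < #|Npos be|) (r == enum_val c)%:R))
    (\matrix_(r < rnum g, c < #|Npair be|)
       let: (i, j) := enum_val c in
       if r == i then - be 0 j else if r == j then be 0 i else 0).

(** The product of P^T with the block matrix, as a function of the outcome o of
the pivot search. *)
Definition transfer a g (o : option 'I_(lnum g)) :
    'M[R]_(lnum g + rnum g, lnum (step a o) + rnum (step a o)) :=
  match o return 'M[R]_(lnum g + rnum g, lnum (step a o) + rnum (step a o)) with
  | Some xi => block_mx (step1F a xi) (step1G a xi) 0 (step1D a xi)
  | None => block_mx 1%:M 0 0 (step2D a g)
  end.

(** The permutation in P^T undoes the ordering N0, N+, N- of the rows. *)
Lemma perm_step2D a g :
  step2D a g = (perm_mx (Nperm (beta a g)))^T *m
    row_mx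
        (row_mx (\matrix_(r < rnum g, c < #|Nzero (beta a g)|)
                    (Nperm (beta a g) r == enum_val c)%:R)
                (\matrix_(r < rnum g, c < #|Npos (beta a g)|)
                    (Nperm (beta a g) r == enum_val c)%:R))
        (\matrix_(r < rnum g, c < #|Npair (beta a g)|)
           let: (i, j) := enum_val c in
           if Nperm (beta a g) r == i then - (beta a g) 0 j
           else if Nperm (beta a g) r == j then (beta a g) 0 i
           else 0).
Proof.
rewrite tr_perm_mx -row_permE /row_perm; apply/matrixP => r c.
by rewrite /step2D !mxE; case: split => c'; [rewrite !mxE; case: split => c''|];
  rewrite !mxE permKV.
Qed.

Lemma transferE a g :
  (Pmx a g)^T *m block_mx (Fmx a g) (Gmx a g) 0 (Dmx a g)
  = transfer a (pivot (alpha a g)).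
Proof.
rewrite /Pmx /Fmx /Gmx /Dmx /next_gens; case: (pivot _) => [xi|] /=.
  by rewrite trmx1 mul1mx.
rewrite tr_block_mx !trmx0 trmx1 mulmx_block !mul1mx !mul0mx !mulmx0 !addr0 !add0r.
by rewrite -perm_step2D.
Qed.

Lemma big_pivot (V : nmodType) q (xi : 'I_q) (F : 'I_q -> V) :
  \sum_i F i = F xi + \sum_(j < q.-1) F (lift xi j).
Proof. exact: (bigD1_ord xi). Qed.

Lemma ltn_lift q (xi : 'I_q) (k : 'I_q.-1) : (xi < lift xi k)%N = ~~ (k < xi)%N.
Proof. rewrite /= /bump -leqNgt; case: leqP => h; lia. Qed.

Lemma sum_enum_val (V : nmodType) (T : finType) (A : {set T}) (F : T -> V) :
  \sum_(x in A) F x = \sum_(k < #|A|) F (enum_val k).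
Proof. exact: big_enum_val. Qed.

Lemma sum_Npair (V : nmodType) p (b : 'rV[R]_p) (F : 'I_p -> 'I_p -> V) :
  \sum_(k < #|Npair b|) (let: (i, j) := enum_val k in F i j)
  = \sum_(i in Npos b) \sum_(j in Nneg b) F i j.
Proof.
rewrite -(sum_enum_val (Npair b) (fun p => let: (i, j) := p in F i j)).
rewrite pair_big_dep; apply: eq_big => [[i j]|[i j] _] //=.
by rewrite in_setX.
Qed.

Lemma sum_delta_r (F : pzRingType) p (i : 'I_p) (f : 'I_p -> F) :
  \sum_j f j * (j == i)%:R = f i.
Proof.
rewrite (bigD1 i) //= eqxx mulr1 big1 ?addr0 // => j /negPf ->.
by rewrite mulr0.
Qed.

Lemma sum_delta_in (F : pzRingType) p (A : {set 'I_p}) (i : 'I_p) (f : 'I_p -> F) :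
  \sum_(j in A) (i == j)%:R * f j = (i \in A)%:R * f i.
Proof.
case: (boolP (i \in A)) => iA; last first.
  rewrite mul0r big1 // => j jA; case: eqP => [ij|]; last by rewrite mul0r.
  by rewrite ij jA in iA.
rewrite (bigD1 i) //= eqxx mul1r big1 ?addr0 // => j /andP[_ ji].
by rewrite eq_sym (negPf ji) mul0r.
Qed.

Lemma gens_step a g (o : option 'I_(lnum g)) :
  row_mx (lmx (step a o)) (rmx (step a o))
  = row_mx (lmx g) (rmx g) *m transfer a o.
Proof.
case: o => [xi|] /=; rewrite mul_row_block !mulmx0 !addr0.
  rewrite /step1F /step1G /step1D; move: (alpha a g) (beta a g) => al be.
  congr row_mx.
    apply/matrixP => r j; rewrite !mxE (big_pivot xi) !mxE.
    rewrite (negPf (neq_lift xi j)) eqxx /=.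
    rewrite (bigD1 j) //= big1 ?addr0; last first.
      move=> j' jj'; rewrite !mxE (inj_eq (@lift_inj _ xi)) (negPf jj').
      by rewrite eq_sym (negPf (neq_lift xi j')) mulr0.
    by rewrite !mxE eqxx; case: (j < xi)%N => /=; ring.
  rewrite !mul_mx_row mulmx0 mul_mx_scalar add_row_mx addr0.
  congr row_mx; apply/matrixP => r j; rewrite !mxE.
    by under eq_bigr do rewrite mxE; rewrite sum_delta_r.
  rewrite addrC; congr (_ + _).
  rewrite (bigD1 xi) //= big1 ?addr0 => [|i /negPf xii]; rewrite !mxE.
    by rewrite eqxx mulrN mulrC.
  by rewrite xii mulr0.
rewrite add0r mulmx1; congr row_mx.
rewrite /step2D; move: (beta a g) => be; rewrite !mul_mx_row; congr row_mx; [congr row_mx|];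
  apply/matrixP => r c; rewrite !mxE.
- by under eq_bigr do rewrite mxE; rewrite sum_delta_r.
- by under eq_bigr do rewrite mxE; rewrite sum_delta_r.
under eq_bigr do rewrite mxE.
have := enum_valP c; case: (enum_val c) => i j /=.
rewrite in_setX !inE => /andP[bi bj].
have ij : j != i by apply: contraTneq bj => ->; rewrite -leNgt ltW.
rewrite (bigD1 i) //= eqxx (bigD1 j) //= (negPf ij) eqxx.
rewrite big1 ?addr0 => [|k /andP[/negPf -> /negPf ->]]; last by rewrite mulr0.
by ring.
Qed.

(** * Transfer of the coordinates *)

Section Field.
Variables (F : fieldType) (iota : {rmorphism R -> F}).

(** The denominator N_tot of Case 2, the sum of beta_i mu_i for i in N+. *)
Definition Ntot a g (c : coords F g) : F :=
  \sum_(i in Npos (beta a g)) c.2 i 0 * iota (beta a g 0 i).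

(** The coordinates c in which the entries mu_j with j in N- are set to 0 in case
N_tot = 0. *)
Definition masked a g (c : coords F g) : coords F g :=
  (c.1, \col_i (if (i \in Nneg (beta a g)) && (Ntot a c == 0) then 0
                else c.2 i 0)).

(** When N_tot = 0 all quotients by N_tot are 0, which leaves the rows in N0 and N+
intact and makes the rows in N- vanish. *)
Lemma step2D_mu a g (c : coords F g) :
  map_mx iota (step2D a g) *m (step2_coords iota a c).2 = (masked a c).2.
Proof.
rewrite /step2D /masked /= -/(Ntot a c); set N := Ntot a c.
have NE : \sum_(i in Npos (beta a g)) c.2 i 0 * iota (beta a g 0 i) = N by [].
move: (beta a g) N NE => be N NE.
rewrite !map_row_mx !mul_row_col.
apply/matrixP => r j0; rewrite (ord1 j0) {j0} !mxE.
under eq_bigr do rewrite !mxE rmorph_nat.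
under [X in _ + X + _]eq_bigr do rewrite !mxE rmorph_nat.
rewrite -(sum_enum_val (Nzero be)
  (fun k => (r == k)%:R * c.2 k 0)).
rewrite -(sum_enum_val (Npos be)
  (fun k => (r == k)%:R * (c.2 k 0 + \sum_(j in Nneg be)
      c.2 j 0 * c.2 k 0 * iota (be 0 j) / N))).
have -> : \sum_(k < #|Npair be|)
   (map_mx iota (\matrix_(r0, c0) (let: (i, j) := enum_val c0 in
     if r0 == i then - be 0 j else if r0 == j then be 0 i else 0)))
     r k *
   (\col_k0 (let: (i, j) := enum_val k0 in c.2 j 0 * c.2 i 0 / N)) k 0
  = \sum_(i in Npos be) \sum_(j in Nneg be)
     iota (if r == i then - be 0 j else if r == j then be 0 i else 0)
     * (c.2 j 0 * c.2 i 0 / N).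
  rewrite -sum_Npair; apply: eq_bigr => k _; rewrite !mxE.
  by case: (enum_val k).
rewrite !sum_delta_in !inE.
case: (ltgtP (be 0 r) 0) => br; rewrite ?mul0r ?mul1r ?add0r ?addr0 /=.
(* r in N-: only the columns (i, r) with i in N+ contribute, and they add up to
   mu_r N_tot / N_tot. *)
- have {}rN : r \in Nneg be by rewrite inE.
  have -> : \sum_(i in Npos be) \sum_(j in Nneg be)
     iota (if r == i then - be 0 j else if r == j then be 0 i else 0)
     * (c.2 j 0 * c.2 i 0 / N)
    = \sum_(i in Npos be) c.2 i 0 * iota (be 0 i)
        * (c.2 r 0 / N).
    apply: eq_bigr => i; rewrite inE => bi.
    have ri : r != i by apply: contraTneq bi => <-; rewrite -leNgt ltW.
    rewrite (bigD1 r) //= (negPf ri) eqxx big1 ?addr0.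
      by rewrite mulrACA mulrA [RHS]mulrCA -!mulrA; congr (_ * _); ring.
    by move=> j /andP[_ jr]; rewrite eq_sym (negPf jr) rmorph0 mul0r.
  rewrite -mulr_suml NE; case: eqP => [->|/eqP N0]; first by rewrite mul0r.
  by rewrite mulrC divfK.
(* r in N+: the columns (r, j) cancel the correction term of the new mu_r. *)
- rewrite -addrA [X in _ + X](_ : _ = 0) ?addr0 //.
  rewrite [\sum_(i in Npos be) _](bigD1 r) ?inE //= addrA -big_split /=.
  rewrite big1 ?add0r.
    rewrite big1 ?addr0 // => i /andP[_ ir]; rewrite big1 // => j.
    rewrite inE eq_sym (negPf ir) => bj.
    have /negPf -> : r != j by apply: contraTneq bj => <-; rewrite -leNgt ltW.
    by rewrite rmorph0 mul0r.
  by move=> j _; rewrite eqxx rmorphN; ring.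
- rewrite big1 ?addr0 // => i; rewrite inE => bi; rewrite big1 // => j.
  rewrite inE => bj.
  have /negPf -> : r != i by apply: contraTneq bi => <-; rewrite br ltxx.
  have /negPf -> : r != j by apply: contraTneq bj => <-; rewrite br ltxx.
  by rewrite rmorph0 mul0r.
Qed.

Lemma coords_step a g (o : option 'I_(lnum g)) (c : coords F g) :
  match o return Prop with
  | Some xi => alpha a g 0 xi != 0
  | None => Ntot a c = 0 -> forall j, j \in Nneg (beta a g) -> c.2 j 0 = 0
  end ->
  map_mx iota (transfer a o) *m
    col_mx (step_coords iota a o c).1 (step_coords iota a o c).2
  = col_mx c.1 c.2.
Proof.
case: o => [xi|] h /=; rewrite ?/step1F ?/step1G ?/step1D;
  [move: (alpha a g) (beta a g) h => al be h|]; rewrite map_block_mx mul_block_col.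
  rewrite map_mx0 mul0mx add0r.
  have h' : iota (al 0 xi) != 0 by rewrite fmorph_eq0.
  congr col_mx; last first.
    rewrite map_row_mx map_mx0 mul_row_col mul0mx add0r map_scalar_mx.
    by apply/matrixP => i j; rewrite mul_scalar_mx !mxE (ord1 j) mulrC divfK.
  rewrite map_row_mx mul_row_col.
  apply/matrixP => i j; rewrite (ord1 j) {j} !mxE big_ord1 !mxE eqxx mulr1n.
  rewrite rmorph_nat.
  case: (unliftP xi i) => [j|] ->.
    rewrite eq_sym (negPf (neq_lift xi j)) mul0r add0r [X in _ + X]big1 ?addr0;
      last by move=> k _; rewrite !mxE eq_sym (negPf (neq_lift xi j)) rmorph0 mul0r.
    rewrite (bigD1 j) //= big1 ?addr0.
      rewrite !mxE eqxx; case: (j < xi)%N; first by rewrite rmorph1 mul1r.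
      by rewrite mulrC divfK.
    move=> k kj; rewrite !mxE (inj_eq (@lift_inj _ xi)) eq_sym (negPf kj).
    by rewrite eq_sym (negPf (neq_lift xi j)) rmorph0 mul0r.
  rewrite eqxx mul1r -addrA -[X in _ + X]addrA -big_split /=.
  rewrite [X in _ + (_ + X)]addrC.
  rewrite [\sum_(i < rnum g) (_ + _)]big1 ?addr0; last first.
    by move=> k _; rewrite !mxE eqxx rmorphN; field.
  rewrite addrCA [X in _ + X](_ : _ = 0) ?addr0 //.
  rewrite add0r [\sum_(i < _ | (xi < i)%N) _]big_mkcond [\sum_(i < lnum g) _](big_pivot xi).
  rewrite /= ltnn add0r -big_split big1 //= => k _.
  rewrite !mxE (negPf (neq_lift xi k)) eqxx ltn_lift /=.
  by case: (k < xi)%N; rewrite /= ?rmorphN ?rmorph0; field.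
congr col_mx.
  by rewrite map_mx1 map_mx0 mul1mx mul0mx addr0.
rewrite map_mx0 mul0mx add0r step2D_mu.
apply/matrixP => i j; rewrite (ord1 j) !mxE; case: ifP => // /andP[iN /eqP /h ->] //.
Qed.

End Field.
End Step.

(** * Signs of the coordinates *)

Section Order.
Variables (R : realType) (n : nat).
Implicit Types (a b : 'rV[R]_n.+1) (g : gens R n).

Lemma pivot_some q (v : 'rV[R]_q) i :
  pivot v = Some i -> v 0 i != 0 /\ forall j : 'I_q, (j < i)%N -> v 0 j = 0.
Proof.
rewrite /pivot; case: pickP => // i' /andP[vi /forallP h] [<-]; split=> // j ji.
by have := h j; rewrite ji => /eqP.
Qed.

Lemma pivot_none q (v : 'rV[R]_q) : pivot v = None <-> v = 0.
Proof.
split; last first.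
  by move=> ->; rewrite /pivot; case: pickP => // i; rewrite mxE eqxx.
rewrite /pivot; case: pickP => // h _; apply/rowP => i; rewrite mxE.
have [j] := ubnPleq (i : nat); elim: j i => [|j IH] i ij.
  apply/eqP/negPn/negP => vi; have := h i; rewrite vi => /negP[].
  by apply/forallP => k; apply/implyP; rewrite ltnNge; lia.
apply/eqP/negPn/negP => vi; have := h i; rewrite vi => /negP[].
by apply/forallP => k; apply/implyP => ki; apply/eqP/IH; lia.
Qed.

Lemma pointE g (c : coords R g) :
  point c = row_mx (lmx g) (rmx g) *m col_mx c.1 c.2.
Proof. by rewrite mul_row_col. Qed.

Lemma mul_point a g (c : coords R g) :
  a *m point c = alpha a g *m c.1 + beta a g *m c.2.
Proof. by rewrite /point mulmxDr !mulmxA. Qed.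

Lemma step2D_ge0 a g i j : 0 <= step2D a g i j.
Proof.
rewrite /step2D !mxE; case: split => j'; rewrite !mxE.
  by case: split => j''; rewrite !mxE.
have := enum_valP j'; case: (enum_val j') => k l /=.
rewrite in_setX !inE => /andP[bk bl].
by case: ifP => _; [rewrite oppr_ge0 ltW|case: ifP => _ //; exact: ltW].
Qed.

Lemma alphaE a g i : alpha a g 0 i = \sum_r a 0 r * lmx g r i.
Proof. exact: mxE. Qed.

Lemma betaE a g i : beta a g 0 i = \sum_r a 0 r * rmx g r i.
Proof. exact: mxE. Qed.

Lemma alpha_step1 a g xi :
  pivot (alpha a g) = Some xi -> alpha a (step1 a xi) = 0.
Proof.
move=> /pivot_some[_ h]; apply/rowP => j; rewrite [RHS]mxE alphaE /=.
under eq_bigr do rewrite mxE.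
case: (boolP (j < xi)%N) => jxi.
  by rewrite -alphaE h //= /bump [(xi <= j)%N]leqNgt jxi.
transitivity (alpha a g 0 xi * alpha a g 0 (lift xi j)
  - alpha a g 0 (lift xi j) * alpha a g 0 xi); last by ring.
rewrite [in X in _ = _ * X - _]alphaE [in X in _ = _ - _ * X]alphaE.
by rewrite !mulr_sumr -sumrB; apply: eq_bigr => r _; ring.
Qed.

Lemma beta_step1 a g xi : beta a (step1 a xi) = row_mx (alpha a g 0 xi)%:M 0.
Proof.
rewrite /beta /= mul_mx_row; congr row_mx; apply/rowP => j; rewrite [RHS]mxE [LHS]mxE.
  by rewrite (ord1 j) eqxx mulr1n alphaE; apply: eq_bigr => r _; rewrite mxE.
under eq_bigr do rewrite mxE.
transitivity (alpha a g 0 xi * beta a g 0 j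
  - beta a g 0 j * alpha a g 0 xi); last by ring.
rewrite [in X in _ = _ * X - _]betaE [in X in _ = _ - _ * X]alphaE.
by rewrite !mulr_sumr -sumrB; apply: eq_bigr => r _; ring.
Qed.

Lemma point_step a g (o : option 'I_(lnum g)) (c : coords R g) :
  match o return Prop with
  | Some xi => alpha a g 0 xi != 0
  | None => Ntot idfun a c = 0 -> forall j, j \in Nneg (beta a g) -> c.2 j 0 = 0
  end ->
  point (step_coords idfun a o c) = point c.
Proof.
by move=> h; rewrite !pointE gens_step -mulmxA -(coords_step h) map_mx_id.
Qed.

(** The only entry of the new mu in Case 1 that is not a rescaled old one is
a y / alpha_xi, because a vanishes on all new generators but the first ray. *)
Lemma step1_mu0 a g xi (c : coords R g) :
  pivot (alpha a g) = Some xi ->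
  (step1_coords idfun a xi c).2 (lshift _ 0) 0
  = (a *m point c) 0 0 / alpha a g 0 xi.
Proof.
move=> pE; have [al0 _] := pivot_some pE.
rewrite -(@point_step a g (Some xi)) // mul_point /= alpha_step1 // mul0mx add0r.
rewrite beta_step1 mul_row_col mul0mx addr0 mul_scalar_mx col_mxEu.
by rewrite [in RHS]mxE mulrC mulKf.
Qed.

Lemma step1_pos a g xi (c : coords R g) :
  pivot (alpha a g) = Some xi -> 0 < alpha a g 0 xi ->
  (forall i, 0 < c.2 i 0) -> 0 < (a *m point c) 0 0 ->
  forall i, 0 < (step1_coords idfun a xi c).2 i 0.
Proof.
move=> pE al_gt0 c_gt0 ac i; case: (split_ordP i) => i' ->.
  by rewrite (ord1 i') step1_mu0 // divr_gt0.
by rewrite col_mxEd mxE divr_gt0.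
Qed.

Lemma step1_nneg a g xi (c : coords R g) :
  pivot (alpha a g) = Some xi -> 0 < alpha a g 0 xi ->
  (forall i, 0 <= c.2 i 0) -> 0 <= (a *m point c) 0 0 ->
  forall i, 0 <= (step1_coords idfun a xi c).2 i 0.
Proof.
move=> pE al_gt0 c_ge0 ac i; case: (split_ordP i) => i' ->.
  by rewrite (ord1 i') step1_mu0 // divr_ge0 // ltW.
by rewrite col_mxEd mxE divr_ge0 // ltW.
Qed.

(** If a vanishes on the columns of L, then a y = N_tot + sum_(j in N-) beta_j mu_j. *)
Lemma mul_point_sign a g (c : coords R g) : alpha a g = 0 ->
  (a *m point c) 0 0 = Ntot idfun a c
     + \sum_(j in Nneg (beta a g)) c.2 j 0 * beta a g 0 j.
Proof.
move=> al0; rewrite mul_point al0 mul0mx add0r /Ntot.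
rewrite [LHS]mxE (bigID (mem (Npos (beta a g)))) /=; congr (_ + _).
  by apply: eq_bigr => i _; rewrite mulrC.
rewrite (bigID (mem (Nneg (beta a g)))) /= [X in _ + X]big1 ?addr0.
  apply: eq_big => [i|i _]; last by rewrite mulrC.
  by rewrite !inE; case: ltgtP.
move=> i; rewrite !inE -!leNgt => /andP[h1 h2].
have -> : beta a g 0 i = 0 by apply/eqP; rewrite eq_le h1 h2.
by rewrite mul0r.
Qed.

(** The new mu_i with i in N+ equals mu_i (a y) / N_tot. *)
Lemma step2_muN a g (c : coords R g) : alpha a g = 0 -> Ntot idfun a c != 0 ->
  forall i, c.2 i 0 + \sum_(j in Nneg (beta a g))
        c.2 j 0 * c.2 i 0 * beta a g 0 j / Ntot idfun a c
  = c.2 i 0 * (a *m point c) 0 0 / Ntot idfun a c.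
Proof.
move=> al0 N0 i; rewrite mul_point_sign // mulrDr mulrDl mulfK //; congr (_ + _).
by rewrite mulr_sumr mulr_suml; apply: eq_bigr => j _; ring.
Qed.

Lemma Ntot_gt0 a g (c : coords R g) : Npos (beta a g) != set0 ->
  (forall i, 0 < c.2 i 0) -> 0 < Ntot idfun a c.
Proof.
move=> /set0Pn[i iP] c_gt0; rewrite /Ntot (bigD1 i) //= ltr_pwDl //.
  by rewrite mulr_gt0 //; move: iP; rewrite inE.
by apply: sumr_ge0 => j /andP[]; rewrite inE => bj _; rewrite mulr_ge0 // ltW.
Qed.

Lemma Ntot_ge0 a g (c : coords R g) : 
  (forall i, 0 <= c.2 i 0) -> 0 <= Ntot idfun a c.
Proof.
by move=> c_ge0; apply: sumr_ge0 => j; rewrite inE => bj; rewrite mulr_ge0 // ltW.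
Qed.

Lemma Ntot_Npos0 (F : fieldType) (iota : {rmorphism R -> F}) a g (c : coords F g) :
  Npos (beta a g) = set0 -> Ntot iota a c = 0.
Proof. by move=> h; rewrite /Ntot h big_set0. Qed.

Lemma step2_pos a g (c : coords R g) : alpha a g = 0 ->
  (Npos (beta a g) != set0 -> 0 < (a *m point c) 0 0) ->
  (forall i, 0 < c.2 i 0) ->
  forall i, 0 < (step2_coords idfun a c).2 i 0.
Proof.
move=> al0 ac c_gt0 i /=; rewrite -/(Ntot idfun a c).
case: (split_ordP i) => i' -> {i}.
  rewrite col_mxEu; case: (split_ordP i') => j -> {i'}.
    by rewrite col_mxEu mxE.
  rewrite col_mxEd mxE.
  have P0 : Npos (beta a g) != set0 by apply/set0Pn; exists (enum_val j); exact: enum_valP.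
  have Nt := Ntot_gt0 P0 c_gt0.
  by rewrite step2_muN ?gt_eqF // divr_gt0 // mulr_gt0 // ac.
rewrite col_mxEd mxE; have := enum_valP i'; case: (enum_val i') => k l.
rewrite in_setX => /andP[kP _].
have P0 : Npos (beta a g) != set0 by apply/set0Pn; exists k.
by rewrite divr_gt0 ?mulr_gt0 // Ntot_gt0.
Qed.

Lemma step2_nneg a g (c : coords R g) : alpha a g = 0 ->
  0 <= (a *m point c) 0 0 ->
  (forall i, 0 <= c.2 i 0) ->
  forall i, 0 <= (step2_coords idfun a c).2 i 0.
Proof.
move=> al0 ac c_ge0 i /=; rewrite -/(Ntot idfun a c).
have Nt := Ntot_ge0 a c_ge0.
case: (split_ordP i) => i' -> {i}.
  rewrite col_mxEu; case: (split_ordP i') => j -> {i'}.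
    by rewrite col_mxEu mxE.
  rewrite col_mxEd mxE.
  have [N0|N0] := eqVneq (Ntot idfun a c) 0; last first.
    by rewrite step2_muN // divr_ge0 // mulr_ge0.
  by rewrite big1 ?addr0 // => k _; rewrite N0 invr0 mulr0.
rewrite col_mxEd mxE; case: (enum_val i') => k l.
by rewrite divr_ge0 // mulr_ge0.
Qed.

Lemma Nneg_vanish a g (c : coords R g) : alpha a g = 0 ->
  0 <= (a *m point c) 0 0 ->
  (forall i, 0 <= c.2 i 0) -> Ntot idfun a c = 0 ->
  forall j, j \in Nneg (beta a g) -> c.2 j 0 = 0.
Proof.
move=> al0 ac c_ge0 N0 j jN; rewrite mul_point_sign // N0 add0r in ac.
have bN : beta a g 0 j < 0 by move: jN; rewrite inE.
have : c.2 j 0 * beta a g 0 j >= 0.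
  apply: le_trans ac _; rewrite (bigD1 j) //= gerDl; apply: sumr_le0 => k.
  by move=> /andP[]; rewrite inE => bk _; rewrite mulr_ge0_le0 // ltW.
rewrite nmulr_lge0 // => cj; apply/eqP; rewrite eq_le cj; exact: c_ge0.
Qed.

(** * The in-place sign change *)

Lemma flip_neq0 a g i : flip a (g := g) i != 0.
Proof. by rewrite /flip; case: ifP => _; rewrite ?oppr_eq0 oner_eq0. Qed.

Lemma flip_sq a g i : flip a (g := g) i * flip a i = 1.
Proof. by rewrite /flip; case: ifP => _; ring. Qed.

Lemma alpha_normalize a g (i : 'I_(lnum g)) :
  alpha a (normalize a g) 0 i = flip a i * alpha a g 0 i.

Proof.
rewrite [LHS]mxE /= [X in _ = _ * X]mxE mulr_sumr.
by apply: eq_bigr => r _; rewrite mxE; ring.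
Qed.

Lemma pivot_normalize a g : pivot (alpha a (normalize a g)) = pivot (alpha a g).
Proof.
have E (i : 'I_(lnum g)) :
    (alpha a (normalize a g) 0 i == 0) = (alpha a g 0 i == 0).
  by rewrite alpha_normalize mulf_eq0 (negPf (flip_neq0 a i)).
rewrite /pivot; apply: eq_pick => i /=; rewrite E; congr (_ && _).
by apply: eq_forallb => j; rewrite E.
Qed.

Lemma normalize_pivot_gt0 a g xi :
  pivot (alpha a (normalize a g)) = Some xi ->
  0 < alpha a (normalize a g) 0 xi.
Proof.
rewrite pivot_normalize => pE; rewrite alpha_normalize /flip pE eqxx /=.
have [al0 _] := pivot_some pE; case: (ltP (alpha a g 0 xi) 0) => al_lt.
  by rewrite mulN1r oppr_gt0.
by rewrite mul1r lt_def al0.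
Qed.

Lemma point_normalize a g (c : coords R g) :
  point (normalize_coords idfun a c) = point c.
Proof.
rewrite /point /=; congr (_ + _); apply/matrixP => i j; rewrite !mxE.
apply: eq_bigr => k _; rewrite !mxE (ord1 j) mulrACA [X in X * _](_ : _ = 1) ?mul1r //.
exact: flip_sq.
Qed.

End Order.

(** * Density of the attained coordinates *)

Section Dense.
Variables (R : realType) (n : nat).
Implicit Types (a b : 'rV[R]_n.+1) (g : gens R n).

Lemma mulmx_gt0 p q (D : 'M[R]_(p, q)) (v : 'cV[R]_q) i :
  (forall i j, 0 <= D i j) -> (exists j, 0 < D i j) -> (forall j, 0 < v j 0) ->
  0 < (D *m v) i 0.
Proof.
move=> D_ge0 [j Dij] v_gt0; rewrite mxE (bigD1 j) //= ltr_pwDl ?mulr_gt0 //.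
by apply: sumr_ge0 => k _; rewrite mulr_ge0 // ltW.
Qed.

Lemma step2D_row_gt0 a g i :
  (i \in Nneg (beta a g) -> Npos (beta a g) != set0) ->
  exists c, 0 < step2D a g i c.
Proof.
move=> iP; case: (ltgtP (beta a g 0 i) 0) => bi.
- have iN : i \in Nneg (beta a g) by rewrite inE.
  have /set0Pn[k kP] := iP iN.
  have kl : (k, i) \in Npair (beta a g) by rewrite in_setX kP iN.
  exists (rshift _ (enum_rank_in kl (k, i))).
  rewrite /step2D row_mxEr mxE enum_rankK_in //.
  move: kP; rewrite inE => kP; rewrite eqxx ifN //.
  by apply: contraTneq kP => <-; rewrite -leNgt ltW.
- have iP' : i \in Npos (beta a g) by rewrite inE.
  exists (lshift _ (rshift _ (enum_rank_in iP' i))).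
  by rewrite /step2D row_mxEl row_mxEr mxE enum_rankK_in // eqxx.
- have iP' : i \in Nzero (beta a g) by rewrite inE bi.
  exists (lshift _ (lshift _ (enum_rank_in iP' i))).
  by rewrite /step2D row_mxEl row_mxEl mxE enum_rankK_in // eqxx.
Qed.

Lemma beta_step2 a g :
  beta a (step2 a g)
  = row_mx (row_mx 0 (\row_(c < #|Npos (beta a g)|) beta a g 0 (enum_val c))) 0.
Proof.
rewrite [LHS]/beta /= !mul_mx_row.
congr row_mx; [congr row_mx|]; apply/rowP => c; rewrite [LHS]mxE [RHS]mxE.
- under eq_bigr do rewrite mxE; rewrite -betaE.
  by have := enum_valP c; rewrite inE => /eqP.
- by under eq_bigr do rewrite mxE; rewrite -betaE.
under eq_bigr do rewrite mxE; case: (enum_val c) => i j.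
transitivity (beta a g 0 i * beta a g 0 j - beta a g 0 j * beta a g 0 i);
  last by ring.
rewrite [in X in _ = _ * X - _]betaE [in X in _ = _ - _ * X]betaE.
by rewrite !mulr_sumr -sumrB; apply: eq_bigr => r _; ring.
Qed.

Lemma mul_point_step2_ge0 a g (u : coords R (step2 a g)) : alpha a g = 0 ->
  (forall i, 0 < u.2 i 0) -> 0 <= (a *m point u) 0 0.
Proof.
move=> al0 u_gt0; rewrite mul_point -[alpha a (step2 a g)]/(alpha a g) al0.
rewrite mul0mx add0r beta_step2 mxE; apply: sumr_ge0 => i _.
apply: mulr_ge0; last exact: ltW.
case: (split_ordP i) => i' ->; last by rewrite row_mxEr mxE.
rewrite row_mxEl; case: (split_ordP i') => i'' ->; first by rewrite row_mxEl mxE.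
by rewrite row_mxEr mxE; have := enum_valP i''; rewrite inE => /ltW.
Qed.

Lemma mul_point_step2_gt0 a g (u : coords R (step2 a g)) : alpha a g = 0 ->
  Npos (beta a g) != set0 ->
  (forall i, 0 < u.2 i 0) -> 0 < (a *m point u) 0 0.
Proof.
move=> al0 /set0Pn[i iP] u_gt0.
rewrite mul_point -[alpha a (step2 a g)]/(alpha a g) al0 mul0mx add0r.
apply: mulmx_gt0 => //.
  move=> k l; rewrite beta_step2 (ord1 k) => {k}.
  case: (split_ordP l) => l' ->; last by rewrite row_mxEr mxE.
  rewrite row_mxEl; case: (split_ordP l') => i'' ->; first by rewrite row_mxEl mxE.
  by rewrite row_mxEr mxE; have := enum_valP i''; rewrite inE => /ltW.
exists (lshift _ (rshift _ (enum_rank_in iP i))).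
rewrite beta_step2 row_mxEl row_mxEr mxE enum_rankK_in //.
by move: iP; rewrite inE.
Qed.

Lemma mul_point_step1_gt0 a g xi (u : coords R (step1 a xi)) :
  pivot (alpha a g) = Some xi -> 0 < alpha a g 0 xi ->
  (forall i, 0 < u.2 i 0) -> 0 < (a *m point u) 0 0.
Proof.
move=> pE al_gt0 u_gt0; rewrite mul_point alpha_step1 // mul0mx add0r.
apply: mulmx_gt0 => //.
  move=> k l; rewrite beta_step1 (ord1 k) => {k}.
  case: (split_ordP l) => l' ->; last by rewrite row_mxEr mxE.
  by rewrite row_mxEl mxE (ord1 l') eqxx ltW.
by exists (lshift _ 0); rewrite beta_step1 row_mxEl mxE eqxx.
Qed.

(** The points with coordinates c in S and mu > 0 are dense in the relative interior
of the cone generated by g, that is, in the set of the points L t + R s with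
s > 0.  A neighbourhood of a point is given by finitely many linear forms that
are positive at it. *)
Definition cone_dense g (S : coords R g -> Prop) :=
  forall (u : coords R g) (Bs : seq 'rV[R]_n.+1),
  (forall i, 0 < u.2 i 0) -> (forall b, b \in Bs -> 0 < (b *m point u) 0 0) ->
  exists c, [/\ S c, forall i, 0 < c.2 i 0
    & forall b, b \in Bs -> 0 < (b *m point c) 0 0].

(** The coordinates computed by one iteration from the elements c of S with
mu > 0. *)
Definition step_image a g (o : option 'I_(lnum g)) (S : coords R g -> Prop)
    (c' : coords R (step a o)) :=
  exists c, [/\ S c, forall i, 0 < c.2 i 0 & c' = step_coords idfun a o c].

Lemma dense_normalize a g (S : coords R g -> Prop) : cone_dense S ->
  cone_dense (fun c' : coords R (normalize a g) =>
    exists2 c, S c & c' = normalize_coords idfun a c).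
Proof.
move=> dS u Bs u_gt0 Bu.
have [|b bB|c [Sc c_gt0 Bc]] := dS (normalize_coords idfun a (u : coords R g)) Bs.
- exact: u_gt0.
- rewrite [point _](_ : _ = point u); first exact: Bu.
  rewrite /point /=; congr (_ + _); apply/matrixP => i j; rewrite !mxE.
  by apply: eq_bigr => k _; rewrite !mxE (ord1 j); ring.
exists (normalize_coords idfun a c); split; first by exists c.
  exact: c_gt0.
by move=> b bB; rewrite point_normalize; exact: Bc.
Qed.

Lemma point_transfer a g (o : option 'I_(lnum g)) (u : coords R (step a o)) t s :
  transfer a o *m col_mx u.1 u.2 = col_mx t s -> point u = point ((t, s) : coords R g).
Proof. by move=> e; rewrite !pointE gens_step -mulmxA e. Qed.

(** Density is preserved if the relative interior of the new cone lies in the part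
a > 0 of the relative interior of the old one, and if at all coordinates with
mu > 0 and a > 0 the iteration keeps the point and the positivity of mu. *)
Lemma dense_open a g (o : option 'I_(lnum g)) (S : coords R g -> Prop) :
  cone_dense S ->
  (forall u : coords R (step a o), (forall i, 0 < u.2 i 0) ->
     0 < (a *m point u) 0 0 /\
     forall i, 0 < dsubmx (transfer a o *m col_mx u.1 u.2) i 0) ->
  (forall c : coords R g, (forall i, 0 < c.2 i 0) -> 0 < (a *m point c) 0 0 ->
     point (step_coords idfun a o c) = point c /\
     forall i, 0 < (step_coords idfun a o c).2 i 0) ->
  cone_dense (step_image S (o := o) (a := a)).
Proof.
move=> dS h1 h2 u Bs u_gt0 Bu.
have [au tu] := h1 u u_gt0.
pose v : coords R g := (usubmx (transfer a o *m col_mx u.1 u.2),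
                        dsubmx (transfer a o *m col_mx u.1 u.2)).
have uv : point u = point v by apply: point_transfer; rewrite vsubmxK.
have [//|b|c [Sc c_gt0 Bc]] := dS v (a :: Bs).
  by rewrite inE -uv => /orP[/eqP -> //|]; exact: Bu.
have [pc c'_gt0] := h2 c c_gt0 (Bc a (mem_head _ _)).
exists (step_coords idfun a o c); split=> //; first by exists c.
by move=> b bB; rewrite pc; apply: Bc; rewrite inE bB orbT.
Qed.

Lemma small_perturbation (T : eqType) (s : seq T) (u v : T -> R) :
  (forall x, x \in s -> 0 < u x) ->
  exists2 d, 0 < d & forall x, x \in s -> 0 < u x + d * v x.
Proof.
move=> u_gt0; pose K := 1 + \sum_(x <- s) `|v x| / u x.
have S_ge0 (s' : seq T) : {subset s' <= s} -> 0 <= \sum_(x <- s') `|v x| / u x.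
  move=> s's; rewrite big_seq; apply: sumr_ge0 => x /s's /u_gt0 ux.
  by rewrite divr_ge0 // ltW.
have K_gt0 : 0 < K by rewrite ltr_pwDl // S_ge0.
exists K^-1; rewrite ?invr_gt0 // => x xs.
have : `|v x| / u x < K.
  by rewrite /K ltr_pwDl // (big_rem x) //= lerDl S_ge0 // => y /mem_rem.
rewrite ltr_pdivrMr ?u_gt0 // => vK.
rewrite -(pmulr_rgt0 _ K_gt0) mulrDr mulVKf ?gt_eqF //.
have := ler_norm (- v x); rewrite normrN; lra.
Qed.

Lemma point_step2 a g (c : coords R g) :
  point (step2_coords idfun a c) = point (masked idfun a c).
Proof.
have := @step2D_mu R n R idfun a g c; rewrite map_mx_id => // e.
rewrite (@point_transfer a g None _ c.1 (masked idfun a c).2) //=.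
by rewrite mul_block_col mul1mx !mul0mx addr0 add0r e.
Qed.

(** Density is preserved when the cone is replaced by its face a = 0. *)
Lemma dense_face a g (S : coords R g -> Prop) :
  alpha a g = 0 -> Npos (beta a g) = set0 -> cone_dense S ->
  cone_dense (step_image S (o := None) (a := a)).
Proof.
move=> al0 P0 dS u' Bs u'_gt0 Bu'.
set N := Nneg (beta a g).
pose u : coords R g := (u'.1, step2D a g *m u'.2).
have uu' : point u' = point u.
  apply: (@point_transfer a g None).
  by rewrite mul_block_col mul1mx !mul0mx addr0 add0r.
pose w : coords R g := (0, \col_j (j \in N)%:R).
(* b + K b *: a is nonpositive on every ray in N-. *)
pose K b := \sum_(j in N) `|beta b g 0 j| / `|beta a g 0 j|.
have K_ge0 b : 0 <= K b by apply: sumr_ge0 => j _; rewrite divr_ge0.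
have K_le b j : j \in N -> beta b g 0 j + K b * beta a g 0 j <= 0.
  move=> jN; have bj : beta a g 0 j < 0 by move: (jN); rewrite inE.
  have : `|beta b g 0 j| / `|beta a g 0 j| <= K b.
    by rewrite /K (bigD1 j) //= lerDl; apply: sumr_ge0 => k _; rewrite divr_ge0.
  rewrite ler_pdivrMr ?normr_gt0 ?lt_eqF // (ltr0_norm bj) mulrN => h.
  by have := ler_norm (beta b g 0 j); lra.
pose f b := b + K b *: a.
have fE b (c : coords R g) : (f b *m point c) 0 0
    = (b *m point c) 0 0 + K b * (a *m point c) 0 0.
  by rewrite mulmxDl -scalemxAl mxE [X in _ + X]mxE.
(* The target is moved off the face by d w, with d small enough to keep every
   form b + K a positive. *)
have [d d_gt0 dB] := small_perturbation (fun b => (f b *m point w) 0 0) Bu'.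
pose v : coords R g := (u.1, u.2 + d *: w.2).
have pv : point v = point u + d *: point w.
  by rewrite /point /= mulmx0 add0r mulmxDr -scalemxAr addrA.
have v_gt0 i : 0 < v.2 i 0.
  rewrite mxE [X in _ + X]mxE [X in _ * X]mxE.
  case: (boolP (i \in N)) => iN.
    rewrite mulr1 ltr_wpDl // mxE; apply: sumr_ge0 => j _.
    by rewrite mulr_ge0 ?step2D_ge0 // ltW.
  rewrite mulr0 addr0; apply: mulmx_gt0 => //; first exact: step2D_ge0.
  by apply: step2D_row_gt0 => iN'; rewrite iN' in iN.
have [//|b /mapP[b' b'B ->]|c [Sc c_gt0 Bc]] := dS v [seq f b | b <- Bs].
  rewrite pv mulmxDr -scalemxAr mxE [X in _ + X]mxE fE -uu'.
  rewrite addrAC; apply: ltr_wpDr; last exact: dB.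
  by rewrite mulr_ge0 // mul_point_step2_ge0.
exists (step_coords idfun a None c); split; first by exists c.
  by apply: step2_pos => //; rewrite P0 eqxx.
move=> b bB; have := Bc _ (map_f f bB); rewrite fE.
rewrite [step_coords _ _ _ _]/(step2_coords idfun a c) point_step2.
rewrite (mul_point_sign _ al0) Ntot_Npos0 // add0r -/N => h.
have -> : (b *m point (masked idfun a c)) 0 0
   = (b *m point c) 0 0 - \sum_(j in N) beta b g 0 j * c.2 j 0.
  rewrite !mul_point /= Ntot_Npos0 // mxE [in RHS]mxE -addrA; congr (_ + _).
  rewrite !mxE (bigID (mem N)) /= big1 ?add0r => [|j jN]; last first.
    by rewrite mxE -/N jN eqxx mulr0.
  rewrite [X in _ = X - _](bigID (mem N)) /= addrAC subrr add0r.
  by apply: eq_bigr => j /negPf jN; rewrite mxE -/N jN.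
(* Dropping the mu_j with j in N- changes b y by at least K b times a y. *)
apply: lt_le_trans h _; rewrite lerD2l mulr_sumr -sumrN; apply: ler_sum => j jN.
have := mulr_le0_ge0 (K_le b j jN) (ltW (c_gt0 j)); lra.
Qed.

End Dense.

(** * One iteration *)

Section Iteration.
Variables (R : realType) (n : nat).
Implicit Types (a b : 'rV[R]_n.+1) (g : gens R n).

(** The pivot search returns o, and the pivot entry, if any, is positive. *)
Definition positive_pivot a g (o : option 'I_(lnum g)) : Prop :=
  pivot (alpha a g) = o /\ (if o is Some xi then 0 < alpha a g 0 xi else true).

Lemma positive_pivot_normalize a g :
  positive_pivot a (pivot (alpha a (normalize a g))).
Proof.
by split=> //; case E: (pivot _) => [xi|//]; exact: normalize_pivot_gt0.
Qed.

Lemma Dmx_ge0 a g i j : 0 <= Dmx a (normalize a g) i j.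
Proof.
have [_] := positive_pivot_normalize a g.
move: i j; rewrite /Dmx /next_gens; case: (pivot _) => [xi|] /= i j al_gt0.
  case: (split_ordP j) => j' ->; first by rewrite row_mxEl mxE.
  by rewrite row_mxEr mxE mulrn_wge0 // ltW.
case: (split_ordP j) => j' ->.
  rewrite row_mxEl; case: (split_ordP j') => j'' ->.
    by rewrite row_mxEl mxE.
  by rewrite row_mxEr mxE.
rewrite row_mxEr mxE; have := enum_valP j'; case: (enum_val j') => k l.
rewrite in_setX !inE => /andP[bk bl].
by case: ifP => _; [rewrite oppr_ge0 ltW|case: ifP => _ //; exact: ltW].
Qed.

Lemma dense_step a g o (S : coords R g -> Prop) :
  positive_pivot a o -> cone_dense S -> cone_dense (step_image S (o := o) (a := a)).
Proof.
case: o => [xi|] [pE al_gt0] dS.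
  apply: dense_open => // [u u_gt0|c c_gt0 ac]; split.
  - exact: mul_point_step1_gt0.
  - move=> i; rewrite mul_block_col col_mxKd mul0mx add0r; apply: mulmx_gt0 => //.
      move=> k l; case: (split_ordP l) => l' ->; first by rewrite row_mxEl mxE.
      by rewrite row_mxEr mxE mulrn_wge0 // ltW.
    by exists (rshift 1 i); rewrite row_mxEr mxE eqxx.
  - by apply: point_step; case: (pivot_some pE).
  - exact: step1_pos.
have al0 := (pivot_none _).1 pE.
have [P0|P0] := eqVneq (Npos (beta a g)) set0; first exact: dense_face.
apply: dense_open => // [u u_gt0|c c_gt0 ac]; split.
- exact: mul_point_step2_gt0.
- move=> i; rewrite mul_block_col col_mxKd mul0mx add0r; apply: mulmx_gt0 => //.
    exact: step2D_ge0.
  exact: step2D_row_gt0.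
- by apply: point_step => N0; have := Ntot_gt0 P0 c_gt0; rewrite N0 ltxx.
- exact: step2_pos.
Qed.

Lemma step_nneg a g o (c : coords R g) : positive_pivot a o ->
  (forall i, 0 <= c.2 i 0) -> 0 <= (a *m point c) 0 0 ->
  point (step_coords idfun a o c) = point c /\
  forall i, 0 <= (step_coords idfun a o c).2 i 0.
Proof.
case: o => [xi|] [pE al_gt0] c_ge0 ac; split.
- by apply: point_step; case: (pivot_some pE).
- exact: step1_nneg.
- apply: point_step; apply: Nneg_vanish => //; exact/pivot_none.
- apply: step2_nneg => //; exact/pivot_none.
Qed.

(** * Values of rational functions *)

(** The rational function f takes the value v at x: it is a quotient of polynomials
whose denominator does not vanish at x. *)
Definition has_value (x : 'cV[R]_n.+1) (f : ratfun R n) (v : R) : Prop :=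
  exists p q : {mpoly R[n.+1]},
    [/\ meval (fun i => x i 0) q != 0, f = tofrac p / tofrac q
      & v = meval (fun i => x i 0) p / meval (fun i => x i 0) q].

Section Value.
Variable x : 'cV[R]_n.+1.
Let ev : {mpoly R[n.+1]} -> R := meval (fun i => x i 0).

Lemma meval_neq0 p : ev p != 0 -> tofrac p != 0 :> ratfun R n.
Proof.
by rewrite tofrac_eq0; apply: contraNneq => ->; rewrite /ev meval0.
Qed.

Lemma has_value_poly p : has_value x (tofrac p) (ev p).
Proof.
exists p, 1; rewrite meval1 oner_eq0 tofrac1 divr1 divr1; split=> //.
Qed.

Lemma has_value_const r : has_value x (ratconst R n r) r.
Proof. by have := has_value_poly (mpolyC n.+1 r); rewrite /ev mevalC. Qed.

Lemma has_value_var i : has_value x (ratvar R n i 0) (x i 0).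
Proof.
by have := has_value_poly (mpolyX R U_(i)%MM); rewrite /ev mevalXU /ratvar mxE.
Qed.

Lemma has_valueD f1 f2 v1 v2 : has_value x f1 v1 -> has_value x f2 v2 ->
  has_value x (f1 + f2) (v1 + v2).
Proof.
move=> [p1 [q1 [h1 -> ->]]] [p2 [q2 [h2 -> ->]]].
exists (p1 * q2 + p2 * q1), (q1 * q2); rewrite !mevalD !mevalM mulf_neq0 //.
by split; rewrite // ?tofracD ?tofracM addf_div // meval_neq0.
Qed.

Lemma has_valueM f1 f2 v1 v2 : has_value x f1 v1 -> has_value x f2 v2 ->
  has_value x (f1 * f2) (v1 * v2).
Proof.
move=> [p1 [q1 [h1 -> ->]]] [p2 [q2 [h2 -> ->]]].
exists (p1 * p2), (q1 * q2); rewrite !mevalM mulf_neq0 //.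
by split; rewrite // ?tofracM mulf_div.
Qed.

Lemma has_valueV f v : v != 0 -> has_value x f v -> has_value x f^-1 v^-1.
Proof.
move=> v0 [p [q [h -> vE]]]; rewrite vE in v0 *.
have p0 : ev p != 0 by apply: contraNneq v0 => p0; rewrite -/(ev p) p0 mul0r.
by exists q, p; rewrite !invf_div.
Qed.

Lemma has_value_div f1 f2 v1 v2 : v2 != 0 -> has_value x f1 v1 -> has_value x f2 v2 ->
  has_value x (f1 / f2) (v1 / v2).
Proof. by move=> v0 h1 h2; apply: has_valueM => //; exact: has_valueV. Qed.

Lemma has_value_sum (I : Type) (r : seq I) (P : pred I) f v :
  (forall i, P i -> has_value x (f i) (v i)) ->
  has_value x (\sum_(i <- r | P i) f i) (\sum_(i <- r | P i) v i).
Proof.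
move=> h; apply: (big_ind2 (has_value x)) => //; last by move=> *; exact: has_valueD.
by have := has_value_const 0; rewrite rmorph0.
Qed.

Lemma has_value_neq0 f v : has_value x f v -> v != 0 -> f != 0.
Proof.
move=> [p [q [h -> ->]]] v0.
have p0 : ev p != 0 by apply: contraNneq v0 => p0; rewrite -/(ev p) p0 mul0r.
by rewrite mulf_neq0 ?invr_eq0 ?meval_neq0.
Qed.

Definition coords_value g (f : coords (ratfun R n) g) (c : coords R g) : Prop :=
  (forall i, has_value x (f.1 i 0) (c.1 i 0)) /\
  (forall i, has_value x (f.2 i 0) (c.2 i 0)).

Lemma coords_value_normalize a g f (c : coords R g) : coords_value f c ->
  coords_value (normalize_coords (ratconst R n) a f) (normalize_coords idfun a c).
Proof.
move=> [h1 h2]; split=> // i; rewrite !mxE.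
by apply: has_valueM => //; exact: has_value_const.
Qed.

Lemma Ntot_value a g f (c : coords R g) : coords_value f c ->
  has_value x (Ntot (ratconst R n) a f) (Ntot idfun a c).
Proof.
move=> [h1 h2]; apply: has_value_sum => i _; apply: has_valueM => //.
exact: has_value_const.
Qed.

(** If mu > 0 at x, then all expressions computed in the next iteration are
defined at x: their denominators are alpha_xi, or N_tot with N+ nonempty. *)
Lemma coords_value_step a g o f (c : coords R g) :
  positive_pivot a o -> coords_value f c -> (forall i, 0 < c.2 i 0) ->
  coords_value (step_coords (ratconst R n) a o f) (step_coords idfun a o c).
Proof.
case: o => [xi|] [pE al_gt0] [h1 h2] c_gt0.
  have hc r : has_value x (tofrac (mpolyC n.+1 r)) r by exact: has_value_const.
  have al0 : alpha a g 0 xi != 0 by rewrite gt_eqF.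
  split=> /= i.
    by rewrite mxE [X in has_value _ _ X]mxE; case: ifP => _ //; exact: has_value_div.
  case: (split_ordP i) => i' ->.
    rewrite !col_mxEu (ord1 i') mxE [X in has_value _ _ X]mxE eqxx !mulr1n.
    apply: has_valueD.
      apply: has_valueD => //; apply: has_value_sum => j _.
      by apply: has_value_div => //; exact: has_valueM.
    apply: has_value_sum => j _.
    by apply: has_value_div => //; exact: has_valueM.
  by rewrite !col_mxEd mxE [X in has_value _ _ X]mxE; exact: has_value_div.
split=> // i /=; rewrite -!/(Ntot _ a _).
have hN := Ntot_value a (conj h1 h2).
have N0 : Npos (beta a g) != set0 -> Ntot idfun a c != 0.
  by move=> P0; rewrite gt_eqF // Ntot_gt0.
case: (split_ordP i) => i' ->.
  rewrite !col_mxEu; case: (split_ordP i') => k ->.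
    by rewrite !col_mxEu mxE [X in has_value _ _ X]mxE.
  rewrite !col_mxEd mxE [X in has_value _ _ X]mxE.
  apply: has_valueD => //; apply: has_value_sum => j _.
  apply: has_value_div => //.
    by apply: N0; apply/set0Pn; exists (enum_val k); exact: enum_valP.
  apply: has_valueM; last exact: has_value_const.
  exact: has_valueM.
rewrite !col_mxEd mxE [X in has_value _ _ X]mxE.
have := enum_valP i'; case: (enum_val i') => k l; rewrite in_setX => /andP[kP _].
apply: has_value_div => //; first by apply: N0; apply/set0Pn; exists k.
exact: has_valueM.
Qed.

End Value.

End Iteration.

(** * The whole algorithm *)

Section Algorithm.
Variables (R : realType) (m n : nat) (A : 'M[R]_(m, n.+1)).

Lemma point_dd0 (x : 'cV[R]_n.+1) : point (numeric A x 0) = x.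
Proof.
apply/colP => r; rewrite !mxE big_ord1 !mxE.
case: (unliftP ord0 r) => [j|] ->.
  rewrite eq_sym (negPf (neq_lift _ _)) mul0r addr0 (bigD1 j) //= big1 ?addr0.
    by rewrite !mxE eqxx mul1r.
  by move=> k kj; rewrite !mxE (inj_eq (@lift_inj _ _)) eq_sym (negPf kj) mul0r.
rewrite eqxx mul1r big1 ?add0r // => j _.
by rewrite !mxE (negPf (neq_lift _ _)) mul0r.
Qed.

(** The numerical values c of the symbolic coordinates f at the points where all of
them are defined. *)
Definition attained g (f : coords (ratfun R n) g) (c : coords R g) : Prop :=
  exists x, coords_value x f c.

Lemma dense_attained_normalize a g (f : coords (ratfun R n) g) :
  cone_dense (attained f) -> cone_dense (attained (normalize_coords (ratconst R n) a f)).
Proof.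
move=> /(@dense_normalize R n a) d u Bs u_gt0 Bu.
have [c [[c0 [x xc] ->] c_gt0 Bc]] := d u Bs u_gt0 Bu.
exists (normalize_coords idfun a c0); split=> //; exists x.
exact: coords_value_normalize.
Qed.

Lemma dense_attained_symbolic k : cone_dense (attained (symbolic A k)).
Proof.
elim: k => [|k IH] u Bs u_gt0 Bu.
  (* Initially L, R is a basis and c(x) are the coordinates of x in it, so the
     target itself is attained. *)
  exists u; split=> //; exists (point u).
  split=> j.
    rewrite mxE (_ : u.1 j 0 = point u (lift ord0 j) 0); first exact: has_value_var.
    rewrite !mxE big_ord1 !mxE [lift _ _ == ord0]eq_sym (negPf (neq_lift _ _)).
    rewrite mul0r addr0 (bigD1 j) //= !mxE eqxx mul1r big1 ?addr0 // => k kj.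
    by rewrite !mxE (inj_eq (@lift_inj _ _)) eq_sym (negPf kj) mul0r.
  rewrite mxE (_ : u.2 j 0 = point u ord0 0); first exact: has_value_var.
  rewrite !mxE big_ord1 !mxE (ord1 j) eqxx mul1r big1 ?add0r // => k _.
  by rewrite !mxE (negPf (neq_lift _ _)) mul0r.
have d := dense_step (positive_pivot_normalize (arow A k) (dd A k))
  (dense_attained_normalize (a := arow A k) IH).
have [c' [[c [[x xc] c_gt0 ->]] c'_gt0 Bc]] := d u Bs u_gt0 Bu.
exists (step_coords idfun (arow A k) _ c); split=> //; exists x.
apply: coords_value_step => //; exact: positive_pivot_normalize.
Qed.

Lemma Ntot_symbolic_neq0 k :
  Npos (beta (arow A k) (dd_in A k)) != set0 ->
  Ntot (ratconst R n) (arow A k) (symbolic_in A k) != 0.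
Proof.
move=> P0.
have d := dense_attained_normalize (a := arow A k) (@dense_attained_symbolic k).
have [||c [[x xc] c_gt0 _]] := d (0, const_mx 1) [::].
- by move=> i; rewrite mxE.
- by [].
apply: has_value_neq0 (Ntot_value _ xc) _.
by rewrite gt_eqF // Ntot_gt0.
Qed.

Lemma arow_mul (k : 'I_m) (x : 'cV[R]_n.+1) :
  (arow A k *m x) 0 0 = (A *m x) k 0.
Proof. by rewrite /arow valK -row_mul mxE. Qed.

(** On K^k the numerical coordinates of x represent x and have mu >= 0. *)
Lemma numeric_inK k x : (k <= m)%N -> inK A k x ->
  point (numeric A x k) = x /\ forall i, 0 <= (numeric A x k).2 i 0.
Proof.
elim: k => [|k IH] km [x0 Ax].
  by split=> [|i]; [exact: point_dd0|rewrite mxE].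
have [|px mu_ge0] := IH (ltnW km).
  by split=> // i ik; apply: Ax; exact: ltnW.
have := @step_nneg R n (arow A k) _ _ (numeric_in A x k)
  (positive_pivot_normalize (arow A k) (dd A k)) mu_ge0.
rewrite [point (numeric_in _ _ _)]point_normalize px.
by apply; rewrite (arow_mul (Ordinal km)); apply: Ax => /=.
Qed.

End Algorithm.

Theorem theorem3 (R : realType) (m n : nat) (A : 'M[R]_(m, n.+1)) (k : 'I_m) :
  let a := arow A k in
  let g := dd_in A k in
  let g' := dd A k.+1 in
  let al := alpha a g in
  let be := beta a g in
  let F : 'M[R]_(lnum g, lnum g') := Fmx a g in
  let G : 'M[R]_(lnum g, rnum g') := Gmx a g in
  let D : 'M[R]_(rnum g, rnum g') := Dmx a g in
  let P : 'M[R]_(lnum g + rnum g) := Pmx a g in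
  let M : 'M[R]_(lnum g + rnum g, lnum g' + rnum g') :=
    P^T *m block_mx F G 0 D in
  [/\ forall i j, 0 <= D i j,
      (lnum g <> 0%N /\ al <> 0) \/ Npos be <> set0 ->
        let c := symbolic_in A k in
        let c' := symbolic A k.+1 in
        col_mx c.1 c.2 = map_mx (ratconst R n) M *m col_mx c'.1 c'.2,
      Npos be = set0 -> lnum g = 0%N \/ al = 0 ->
        forall x : 'cV[R]_n.+1, inK A k.+1 x ->
        let c := numeric_in A x k in
        let c' := numeric A x k.+1 in
        col_mx c.1 c.2 = M *m col_mx c'.1 c'.2 /\
        (forall j, j \in Nneg be -> c.2 j 0 = 0)
    & row_mx (lmx g') (rmx g') = row_mx (lmx g) (rmx g) *m M].
Proof.
move=> a g g' al be F G D P M.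
have ME : M = transfer a (pivot al) by exact: transferE.
split.
- exact: Dmx_ge0.
- move=> h c c'; rewrite ME; apply/esym/coords_step.
  have : forall o, pivot al = o -> match o return Prop with
  | Some xi => alpha a g 0 xi != 0
  | None => Ntot (ratconst R n) a c = 0 -> forall j, j \in Nneg (beta a g) -> c.2 j 0 = 0
  end; last by apply.
  case=> [xi /pivot_some[] //|/pivot_none al0 N0].
  case: h => [[]//|/eqP /Ntot_symbolic_neq0]; by rewrite N0 eqxx.
- move=> P0 h x Kx c c'.
  have al0 : al = 0.
    case: h => // q0; apply/rowP => i.
    by case: (i) => i0 i0q; exfalso; rewrite q0 in i0q.
  have pN : pivot al = None by apply/pivot_none.
  have [|px c_ge0] := @numeric_inK R m n A k x (ltnW (ltn_ord k)).
    by case: Kx => x0 Ax; split=> // i ik; apply: Ax; exact: ltnW.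
  have vanish : forall j, j \in Nneg be -> c.2 j 0 = 0.
    apply: Nneg_vanish => //; last exact: Ntot_Npos0.
    by rewrite [point c]point_normalize px arow_mul; case: Kx => _; apply.
  split=> //; rewrite ME.
  have := @coords_step R n R idfun a g (pivot al) c; rewrite map_mx_id // => E.
  by apply/esym/E; rewrite pN => _.
- by rewrite ME; exact: gens_step.
Qed.
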